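(* Let $X=\sum_{\alpha\in\mathcal X}I_\alpha$, $\mu=\mathbb E X$, $\Pi$, $\delta$ and $\varphi$ be as defined in the context. If $\varepsilon\in[0,1]$, $\max\{\Pi,\mathbf 1_{\{\varepsilon<1\}}\delta\}\le 2^{-14}$ and $\varepsilon^2\mu\ge \mathbf 1_{\{\varepsilon<1\}}$, then $$\mathbb P(X\le(1-\varepsilon)\mathbb E X)\ \ge\ \exp\{-(1+\xi)\varphi(-\varepsilon)\mu\},$$ with $\xi=135\max\{\Pi^{1/8},\ \mathbf 1_{\{\varepsilon<1\}}\delta^{1/8},\ \mathbf 1_{\{\varepsilon<1\}}(\varepsilon^2\mu)^{-1/4}\}$.
   Context: Setting: $\Gamma$ is a finite set with $|\Gamma|=N$, $\mathbf p=(p_i)_{i\in\Gamma}\in[0,1]^N$, and $\Gamma_{\mathbf p}\subseteq\Gamma$ is the random subset in which each $i\in\Gamma$ is included independently with probability $p_i$. $(Q(\alpha))_{\alpha\in\mathcal X}$ is a family of subsets of $\Gamma$ indexed by a finite nonempty set $\mathcal X$, $I_\alpha=\mathbf 1_{\{Q(\alpha)\subseteq\Gamma_{\mathbf p}\}}$, and $X=\sum_{\alpha\in\mathcal X}I_\alpha$. Write $\alpha\sim\beta$ if $\alpha\ne\beta$ and $Q(\alpha)\cap Q(\beta)\neq\emptyset$. Put $\mu=\mathbb E X$, $\Pi=\max_{\alpha\in\mathcal X}\mathbb E I_\alpha$, $\Lambda=\mu+\sum_{(\alpha,\beta)\in\mathcal X\times\mathcal X:\,\alpha\sim\beta}\mathbb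 E I_\alpha I_\beta$, and define $\delta\ge0$ by $\Lambda=(1+\delta)\mu$ (if $\mu=0$, so $\Lambda=0$, put $\delta=0$). The function $\varphi$ is $\varphi(x)=(1+x)\log(1+x)-x$ for $x\ge -1$, with $\varphi(-1)=1$. $\mathbf 1_{\{A\}}$ equals $1$ if $A$ holds and $0$ otherwise; terms multiplied by a zero indicator are $0$. *)

(* Defs.v *)
From mathcomp Require Export all_boot all_order all_algebra.
From mathcomp Require Export reals sequences exp.

Set Implicit Arguments.
Unset Strict Implicit.
Unset Printing Implicit Defensive.

Import Order.TTheory GRing.Theory Num.Theory.
Local Open Scope ring_scope.

Section RandomSubset.
Variables (R : realType) (Gamma : finType) (p : Gamma -> R).

(* The law of Gamma_p, i.e. the product of Bernoulli(p i) measures transported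
   to {set Gamma}; the sample point S is the realised subset itself. *)
Definition subset_weight (S : {set Gamma}) : R :=
  (\prod_(i in S) p i) * (\prod_(i in ~: S) (1 - p i)).

Definition prob (A : pred {set Gamma}) : R :=
  \sum_(S : {set Gamma} | A S) subset_weight S.

Definition expect (f : {set Gamma} -> R) : R :=
  \sum_(S : {set Gamma}) subset_weight S * f S.

Lemma prob_subset (B : {set Gamma}) :
  prob (fun S => B \subset S) = \prod_(i in B) p i.
Proof.
rewrite /prob /subset_weight.
pose F (i : Gamma) (b : bool) : R := if b then p i else
  (if i \in B then 0 else 1 - p i).
have -> : \prod_(i in B) p i = \prod_i \sum_(b : bool) F i b.
  rewrite (big_mkcond (mem B)) /=; apply: eq_bigr => i _.
  by rewrite big_bool /F /=; case: (i \in B); rewrite ?addr0 // addrC subrK.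
rewrite bigA_distr_bigA /=.
rewrite (reindex (fun f : {ffun Gamma -> bool} => [set i | f i])) /=; last first.
  exists (fun S : {set Gamma} => [ffun i => i \in S]) => [f _|S _].
    by apply/ffunP => i; rewrite ffunE inE.
  by apply/setP => i; rewrite inE ffunE.
rewrite big_mkcond; apply: eq_bigr => f _ /=.
case: ifPn => [/subsetP sBf|/subsetPn[i iB]].
  rewrite [RHS](bigID (fun i => f i)) /=; congr (_ * _).
    by apply: eq_big => [i|i]; rewrite inE // => fi; rewrite /F fi.
  apply: eq_big => [i|i]; rewrite !inE // => /negbTE fi; rewrite /F fi.
  by case: ifP => // /sBf; rewrite inE fi.
by rewrite inE => /negbTE fi; rewrite (bigD1 i) //= /F fi iB mul0r.
Qed.

Lemma prob_total : prob predT = 1.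
Proof.
have := prob_subset set0; rewrite big_set0 => <-.
by apply: eq_bigl => S; rewrite sub0set.
Qed.

End RandomSubset.

Section SubsetCounts.
Variables (R : realType) (Gamma Xi : finType).
Variables (p : Gamma -> R) (Q : Xi -> {set Gamma}).

Definition indic (a : Xi) (S : {set Gamma}) : R := (Q a \subset S)%:R.

Definition subset_count (S : {set Gamma}) : R := \sum_(a : Xi) indic a S.

Definition dependent (a b : Xi) : bool := (a != b) && (Q a :&: Q b != set0).

Definition mu : R := expect p subset_count.

(* The default 0 of the iterated maximum is harmless: expectations of
   indicators are nonnegative and Xi is nonempty in the statement. *)
Definition max_prob : R := \big[Num.max/0]_(a : Xi) expect p (indic a).

Definition Lambda : R :=
  mu + \sum_(ab : Xi * Xi | dependent ab.1 ab.2)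
         expect p (fun S => indic ab.1 S * indic ab.2 S).

Definition delta : R := if mu == 0 then 0 else Lambda / mu - 1.

Hypothesis p01 : forall i, 0 <= p i <= 1.

Lemma subset_weight_ge0 S : 0 <= subset_weight p S.
Proof.
by apply: mulr_ge0; apply: prodr_ge0 => i _; case/andP: (p01 i);
  rewrite ?subr_ge0.
Qed.

Lemma mu_sum : mu = \sum_(a : Xi) expect p (indic a).
Proof.
by rewrite /mu /expect exchange_big /=; apply: eq_bigr => S _; rewrite mulr_sumr.
Qed.

Lemma expect_indic_ge0 a : 0 <= expect p (indic a).
Proof. by apply: sumr_ge0 => S _; rewrite mulr_ge0 ?subset_weight_ge0. Qed.

Lemma expect_indicM_ge0 a b : 0 <= expect p (fun S => indic a S * indic b S).
Proof.
by apply: sumr_ge0 => S _; rewrite mulr_ge0 ?subset_weight_ge0 ?mulr_ge0.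
Qed.

Lemma Lambda_delta : Lambda = (1 + delta) * mu.
Proof.
rewrite /delta; case: eqVneq => [mu0|mu0]; last first.
  by rewrite addrC subrK divfK.
rewrite /Lambda mu0 mulr0 add0r; apply: big1 => -[a b] _ /=.
have Ia0 : expect p (indic a) = 0.
  have := mu0; rewrite mu_sum => /eqP.
  rewrite psumr_eq0; last by move=> c _; exact: expect_indic_ge0.
  by move/allP/(_ a (mem_index_enum a))/eqP.
apply/eqP; rewrite eq_le expect_indicM_ge0 andbT -Ia0.
apply: ler_sum => S _; apply: ler_wpM2l; first exact: subset_weight_ge0.
by rewrite /indic -natrM ler_nat; do 2!case: (_ \subset _).
Qed.

Lemma delta_ge0 : 0 <= delta.
Proof.
rewrite /delta; case: eqVneq => // mu0.
have mu_gt0 : 0 < mu.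
  rewrite lt_def mu0 mu_sum; apply: sumr_ge0 => a _; exact: expect_indic_ge0.
rewrite subr_ge0 ler_pdivlMr // mul1r lerDl.
by apply: sumr_ge0 => -[a b] _; exact: expect_indicM_ge0.
Qed.

End SubsetCounts.

Definition phi (R : realType) (x : R) : R :=
  if x == -1 then 1 else (1 + x) * ln (1 + x) - x.

Definition xi (R : realType) (Gamma Xi : finType) (p : Gamma -> R)
    (Q : Xi -> {set Gamma}) (eps : R) : R :=
  135 * Num.max (max_prob p Q `^ 8^-1)
          (Num.max ((eps < 1)%R%:R * delta p Q `^ 8^-1)
                   ((eps < 1)%R%:R * (eps ^+ 2 * mu p Q) `^ (- 4^-1))).

(* Main.v *)
(* Exponential tilting.  Write F(s) = E exp(-sX), u = 1 - eps and
   rate(u) = u log u + 1 - u = phi(-eps).  Harris' inequality gives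
     log F(s) >= -mu x - 2 Pi mu x^2          with x = 1 - exp(-s),
   and Janson's argument, applied to the logarithmic derivative of F, gives
     log F(s) <= -mu x + delta mu rate(exp(-s)),
   so X is nearly Poisson on the level of Laplace transforms.  With v = u - d
   and w = u - 2d for a suitable d of order eps ell^2, where xi = 135 ell, the
   law of X tilted by exp(-sX) with exp(-s) = v is concentrated on
   [w mu, u mu], whence
     P(X <= u mu) >= exp(-1 - (1 + 4 eta) mu rate(w)),   eta = max(Pi, delta).
   When u is too small for this, P(X = 0) >= exp(-(1 + 2 Pi) mu) suffices. *)

Require Import Defs.
From mathcomp Require Import boolp functions reals topology normedtype derive.
From mathcomp Require Import realfun sequences exp.
From mathcomp Require Import all_boot all_order all_algebra.
From mathcomp Require Import ring lra.

Set Implicit Arguments.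
Unset Strict Implicit.
Unset Printing Implicit Defensive.

Import Order.TTheory GRing.Theory Num.Theory numFieldNormedType.Exports.
Local Open Scope ring_scope.

(** * Expectation over the random subset *)

Section Expectation.
Variables (R : realType) (Gamma : finType) (p : Gamma -> R).
Implicit Types (f g : {set Gamma} -> R) (S : {set Gamma}) (i : Gamma).

Lemma eq_expect f g : f =1 g -> expect p f = expect p g.
Proof. by move=> fg; apply: eq_bigr => S _; rewrite fg. Qed.

Lemma expectD f g :
  expect p (fun S => f S + g S) = expect p f + expect p g.
Proof. by rewrite -big_split; apply: eq_bigr => S _; rewrite mulrDr. Qed.

Lemma expectZ c f : expect p (fun S => c * f S) = c * expect p f.
Proof. by rewrite mulr_sumr; apply: eq_bigr => S _; rewrite mulrCA. Qed.

Lemma expect_sum (I : Type) (r : seq I) (P : pred I)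
    (F : I -> {set Gamma} -> R) :
  expect p (fun S => \sum_(k <- r | P k) F k S)
  = \sum_(k <- r | P k) expect p (F k).
Proof.
by rewrite /expect exchange_big; apply: eq_bigr => S _; rewrite mulr_sumr.
Qed.

Lemma expect_cst c : expect p (fun=> c) = c.
Proof. by rewrite /expect -mulr_suml [X in X * c](prob_total p) mul1r. Qed.

Lemma prob_expect (A : pred {set Gamma}) :
  prob p A = expect p (fun S => (A S)%:R).
Proof.
rewrite /prob big_mkcond; apply: eq_bigr => S _.
by case: (A S); rewrite ?mulr1 ?mulr0.
Qed.

Hypothesis p01 : forall i, 0 <= p i <= 1.

Lemma ler_expect f g : (forall S, f S <= g S) -> expect p f <= expect p g.
Proof.
by move=> fg; apply: ler_sum => S _; rewrite ler_wpM2l ?subset_weight_ge0.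
Qed.

Lemma expect_ge0 f : (forall S, 0 <= f S) -> 0 <= expect p f.
Proof. by move=> f0; rewrite -(expect_cst 0); apply: ler_expect. Qed.

End Expectation.

(** * Resampling one element at a time, and Harris' inequality *)

Section Resampling.
Variables (R : realType) (Gamma : finType).
Implicit Types (p : Gamma -> R) (f g : {set Gamma} -> R) (S : {set Gamma}).
Implicit Types (i j : Gamma) (r : seq Gamma).

(** The conditional expectation of [f] given the state of every element other than [i]. *)
Definition resample p i f S := p i * f (i |: S) + (1 - p i) * f (S :\ i).

Definition resample_seq p r f := foldr (resample p) f r.

Definition insensitive i f := forall S S', S :\ i = S' :\ i -> f S = f S'.

Definition nonincreasing_set f := forall S S', S \subset S' -> f S' <= f S.

Lemma setU1D1 i S : (i |: S) :\ i = S :\ i.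
Proof. by apply/setP => j; rewrite !inE; case: eqVneq. Qed.

Lemma resample_id p i f S : insensitive i f -> resample p i f S = f S.
Proof.
move=> fi; rewrite /resample (fi (i |: S) S) ?setU1D1//.
rewrite (fi (S :\ i) S); last by rewrite setDDl setUid.
by rewrite -mulrDl addrC subrK mul1r.
Qed.

Lemma resample_insensitive p i f : insensitive i (resample p i f).
Proof.
move=> S S' eqS; rewrite /resample eqS; congr (_ * f _ + _).
by apply/setP => k; move/setP/(_ k): eqS; rewrite !inE; case: eqVneq.
Qed.

Lemma insensitive_resample p i j f :
  insensitive j f -> insensitive j (resample p i f).
Proof.
move=> fj S S' eqS.
have eqSk k : k != j -> (k \in S) = (k \in S').
  by move=> kj; move/setP/(_ k): eqS; rewrite !inE kj.
rewrite /resample; congr (_ * _ + _ * _); apply: fj; apply/setP => k;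
  by rewrite !inE; case: eqVneq => //= /eqSk ->.
Qed.

(** Each [S] avoiding [i] is paired with [i |: S]. The relation [wU] between their weights is kept
    cross-multiplied, so that [p i] may be 0 or 1. *)
Lemma expect_resample p i f : expect p (resample p i f) = expect p f.
Proof.
have wU S : i \notin S ->
    (1 - p i) * subset_weight p (i |: S) = p i * subset_weight p S.
  move=> iS; rewrite /subset_weight big_setU1//=.
  have -> : ~: S = i |: ~: (i |: S).
    by apply/setP => k; rewrite !inE; case: eqVneq => // ->.
  by rewrite big_setU1 ?inE ?eqxx//=; ring.
have split_i g : expect p g = \sum_(S : {set Gamma} | i \notin S)
    (subset_weight p S * g S + subset_weight p (i |: S) * g (i |: S)).
  rewrite /expect (bigID (fun S : {set Gamma} => i \notin S)) /= big_split /=.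
  congr (_ + _).
  rewrite (reindex_onto (fun S => i |: S) (fun S => S :\ i)) /=; last first.
    by move=> S; rewrite negbK => iS; rewrite setD1K.
  apply: eq_bigl => S; rewrite !inE eqxx /=.
  apply/eqP/idP => [<-|iS]; first by rewrite !inE eqxx.
  by rewrite setU1K.
rewrite !split_i; apply: eq_bigr => S iS.
have SDi : S :\ i = S by rewrite -[in LHS](setU1K iS) setDDl setUid setU1K.
rewrite /resample setUA setUid setU1D1 SDi.
have wE := wU S iS.
apply/eqP; rewrite -subr_eq0; apply/eqP.
transitivity ((p i * subset_weight p S - (1 - p i) * subset_weight p (i |: S))
              * (f (i |: S) - f S)); first by ring.
by rewrite wE subrr mul0r.
Qed.

Lemma expect_resample_seq p r f : expect p (resample_seq p r f) = expect p f.
Proof. by elim: r => //= i r <-; rewrite expect_resample. Qed.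

Lemma resample_seq_insensitive p r f i :
  i \in r -> insensitive i (resample_seq p r f).
Proof.
elim: r => //= j r IHr; rewrite in_cons; case: eqVneq => [-> _|_ /= /IHr].
  exact: resample_insensitive.
exact: insensitive_resample.
Qed.

Lemma insensitive_cst f S : (forall i, insensitive i f) -> f S = f set0.
Proof.
move=> fi; elim: {S}_.+1 {-2}S (ltnSn #|S|) => // n IHn S.
have [->//|[i iS]] := set_0Vmem S.
rewrite ltnS (cardsD1 i) iS => /IHn <-.
by apply: (fi i); rewrite setDDl setUid.
Qed.

(** Once every element has been resampled, the function depends on no coordinate and is therefore
    constant. This turns statements about expectations into inductions over a list of elements. *)
Lemma expectE_resample p f S : expect p f = resample_seq p (enum Gamma) f S.
Proof.
have cst S' := insensitive_cst S'
  (fun i => @resample_seq_insensitive p _ f i (mem_enum _ i)).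
rewrite -(expect_resample_seq p (enum Gamma)) (eq_expect _ cst) expect_cst.
by rewrite cst.
Qed.

(** Resampling [i] is the same operation for [p] and [q] where they agree, and does nothing where
    they differ. *)
Lemma eq_expect_insensitive p q f :
  (forall i, p i <> q i -> insensitive i f) -> expect p f = expect q f.
Proof.
move=> fi; rewrite !(expectE_resample _ _ set0).
suff H r : resample_seq p r f =1 resample_seq q r f by rewrite H.
elim: r => //= i r IHr S; have [pq|/eqP pq] := eqVneq (p i) (q i).
  by rewrite /resample pq !IHr.
have ins r' : insensitive i (resample_seq q r' f).
  elim: r' => [|j r' IH]; first exact: fi.
  exact: insensitive_resample.
by rewrite resample_id -?IHr ?resample_id// => S1 S2 /ins; rewrite !IHr.
Qed.

Section Harris.
Variable p : Gamma -> R.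
Hypothesis p01 : forall i, 0 <= p i <= 1.

Lemma resample_nonincreasing i f :
  nonincreasing_set f -> nonincreasing_set (resample p i f).
Proof.
move=> fd S S' SS'; have /andP[p0 p1] := p01 i.
by rewrite lerD ?ler_wpM2l ?subr_ge0// fd ?setUS ?setSD.
Qed.

(** Induction over the resampled elements. For a single element the difference of the two sides is
    the covariance [cov] of two functions of one Bernoulli variable that are monotone in the same
    direction. *)
Lemma resample_seq_mul r f g S :
    nonincreasing_set f -> nonincreasing_set g ->
  resample_seq p r f S * resample_seq p r g S
  <= resample_seq p r (fun S => f S * g S) S.
Proof.
move=> fd gd; elim: r S => //= i r IHr S; have /andP[p0 p1] := p01 i.
have rd h : nonincreasing_set h -> nonincreasing_set (resample_seq p r h).
  by move=> hd; elim: (r) => //= j r' IH; exact: resample_nonincreasing.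
have sub : S :\ i \subset i |: S.
  by rewrite (subset_trans (subD1set _ _)) ?subsetUr.
have := rd _ fd _ _ sub; have := rd _ gd _ _ sub.
have := IHr (i |: S); have := IHr (S :\ i); rewrite /resample.
set f1 := resample_seq p r f (i |: S); set f2 := resample_seq p r f (S :\ i).
set g1 := resample_seq p r g (i |: S); set g2 := resample_seq p r g (S :\ i).
set h1 := resample_seq _ _ _ (i |: S); set h2 := resample_seq _ _ _ (S :\ i).
move=> H2 H1 g12 f12.
have q0 : 0 <= 1 - p i by rewrite subr_ge0.
have cov : 0 <= p i * (1 - p i) * ((f2 - f1) * (g2 - g1)).
  by rewrite !mulr_ge0 ?subr_ge0.
have := ler_wpM2l p0 H1; have := ler_wpM2l q0 H2; lra.
Qed.

Lemma harris f g : nonincreasing_set f -> nonincreasing_set g ->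
  expect p f * expect p g <= expect p (fun S => f S * g S).
Proof.
by move=> fd gd; rewrite !(expectE_resample _ _ set0) resample_seq_mul.
Qed.

Lemma harris_prod (I : Type) (r : seq I) (F : I -> {set Gamma} -> R) :
    (forall k S, 0 <= F k S) -> (forall k, nonincreasing_set (F k)) ->
  \prod_(k <- r) expect p (F k) <= expect p (fun S => \prod_(k <- r) F k S).
Proof.
move=> F0 Fd; elim: r => [|k r IHr].
  by under eq_expect => S do rewrite big_nil; rewrite big_nil expect_cst.
under eq_expect => S do rewrite big_cons; rewrite big_cons.
apply: le_trans (harris (Fd k) _); first by rewrite ler_wpM2l ?expect_ge0.
move=> S S' SS'; elim: (r) => [|j r' IH]; rewrite ?big_nil// !big_cons.
by rewrite ler_pM ?prodr_ge0//; exact: Fd.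
Qed.

End Harris.
End Resampling.

(** * Elementary calculus with the exponential *)

Section Calculus.
Variable R : realType.
Implicit Types (x y s : R).

Lemma le_at0_derive (f f' : R -> R) : (forall x, is_derive x 1 f (f' x)) ->
  (forall x, 0 <= x -> f' x <= 0) -> forall x, 0 <= x -> f x <= f 0.
Proof.
move=> fD f'le0 x x0.
have Df y : derivable f y 1 by have [] := fD y.
apply: (@ler0_derive1_nincry _ _ 0) => // [y|].
  rewrite in_itv/= andbT => /ltW /f'le0.
  by rewrite derive1E; have [_ ->] := fD y.
exact: derivable_within_continuous.
Qed.

Lemma is_derive_sum_fin (T : finType) (h : T -> R -> R) (dh : T -> R) x :
    (forall t, is_derive x 1 (h t) (dh t)) ->
  is_derive x 1 (fun y => \sum_t h t y) (\sum_t dh t).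
Proof.
move=> hD.
have -> : (fun y => \sum_t h t y) = \sum_t h t.
  by apply/boolp.funext => y; rewrite fct_sumE.
elim/big_ind2 : _ => // [|] *; [exact: is_derive_cst|exact: is_deriveD].
Qed.

Lemma is_derive_expRN x : is_derive x 1 (fun y => expR (- y)) (- expR (- x)).
Proof.
rewrite -mulrN1; exact: (@is_derive1_comp R expR -%R).
Qed.

(** The inverse of [1 - y] is [1 + y / (1 - y)], hence at most [expR (y / (1 - y))]; for [y] up to
    one half the exponent is at most [y + 2 * y ^+ 2]. *)
Lemma expRN_quadratic_le y : 0 <= y <= 2^-1 ->
  expR (- (y + 2 * y ^+ 2)) <= 1 - y.
Proof.
move=> /andP[y0 y1]; have y1' : 0 < 1 - y by lra.
have yV : y / (1 - y) <= y + 2 * y ^+ 2.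
  rewrite ler_pdivrMr//.
  have : 0 <= y ^+ 2 * (1 - 2 * y) by rewrite mulr_ge0 ?sqr_ge0//; lra.
  rewrite expr2; lra.
rewrite (le_trans (y := expR (- (y / (1 - y)))))// ?ler_expR ?lerN2//.
rewrite expRN -[leRHS]invrK lef_pV2 ?posrE ?expR_gt0 ?invr_gt0//.
rewrite (le_trans _ (expR_ge1Dx _))//.
have e : (1 - y)^-1 = 1 + y / (1 - y) by field; rewrite gt_eqF.
by rewrite {1}e.
Qed.

End Calculus.

(** * Two-sided bounds on the Laplace transform of the count *)

Section Laplace.
Variables (R : realType) (Gamma Xi : finType).
Variables (p : Gamma -> R) (Q : Xi -> {set Gamma}).
Hypothesis p01 : forall i, 0 <= p i <= 1.

Local Notation X := (subset_count R Q).
Local Notation Ind := (indic R Q).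
Local Notation mu := (mu p Q).
Local Notation delta := (delta p Q).
Local Notation Pi := (max_prob p Q).

Lemma indic01 a S : 0 <= Ind a S <= 1.
Proof. by rewrite ler0n lern1 leq_b1. Qed.

Lemma subset_count_ge0 S : 0 <= X S.
Proof. by apply: sumr_ge0 => a _; case/andP: (indic01 a S). Qed.

Lemma indic_nondecreasing a (S S' : {set Gamma}) :
  S \subset S' -> Ind a S <= Ind a S'.
Proof.
move=> SS'; rewrite ler_nat; case: (boolP (Q a \subset S)) => // QS.
by rewrite (subset_trans QS).
Qed.

Lemma expect_indic_le_max a : expect p (Ind a) <= Pi.
Proof. exact: le_bigmax. Qed.

Lemma max_prob_ge0 : 0 <= Pi.
Proof. exact: bigmax_ge_id. Qed.

Lemma mu_ge0 : 0 <= mu.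
Proof. by apply: expect_ge0 => // S; exact: subset_count_ge0. Qed.

(** Harris' inequality for the nonincreasing factors [1 - x * Ind a S], followed by
    [expRN_quadratic_le] for each mean. The squares of the means sum to at most [Pi * mu]. Taking
    [x = 1 - expR (- s)] yields the Laplace transform, and [x = 1] the event that the count
    vanishes. *)
Lemma expect_prod_ge x : 0 <= x <= 1 -> Pi <= 2^-1 ->
  expR (- (mu * x + 2 * Pi * mu * x ^+ 2))
  <= expect p (fun S => \prod_a (1 - x * Ind a S)).
Proof.
move=> /andP[x0 x1] Pi2.
apply: le_trans (harris_prod p01 _ _ _) => [|a S|a S S' SS'].
- rewrite mu_sum mulr_sumr !mulr_suml -big_split -sumrN expR_sum.
  apply: ler_prod => a _; rewrite expR_ge0 /=.
  have -> : expect p (fun S => 1 - x * Ind a S) = 1 - x * expect p (Ind a).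
    under eq_expect => S do rewrite -mulNr.
    by rewrite expectD expect_cst expectZ mulNr.
  have e0 := expect_indic_ge0 Q p01 a; have eP := expect_indic_le_max a.
  have e1 : expect p (Ind a) <= 2^-1 by exact: le_trans eP Pi2.
  apply: le_trans (expRN_quadratic_le _); last first.
    rewrite mulr_ge0// (le_trans (ler_piMl e0 x1))//.
  rewrite ler_expR lerN2 [expect _ _ * x]mulrC lerD2l exprMn.
  have := mulr_ge0 (mulr_ge0 (sqr_ge0 x) e0) (_ : 0 <= Pi - expect p (Ind a)).
  by rewrite subr_ge0 eP => /(_ isT); rewrite !expr2; lra.
- have /andP[i0 i1] := indic01 a S.
  by rewrite subr_ge0 mulr_ile1.
- by rewrite lerD2l lerN2 ler_wpM2l// indic_nondecreasing.
Qed.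

Definition laplace s := expect p (fun S => expR (- (s * X S))).

Lemma expRN_indic s a S :
  expR (- (s * Ind a S)) = 1 - (1 - expR (- s)) * Ind a S.
Proof.
rewrite /indic; case: (_ \subset _); rewrite ?mulr1 ?mulr0 ?oppr0 ?expR0; lra.
Qed.

Lemma laplace_ge s : 0 <= s -> Pi <= 2^-1 ->
  expR (- (mu * (1 - expR (- s)) + 2 * Pi * mu * (1 - expR (- s)) ^+ 2))
  <= laplace s.
Proof.
move=> s0 Pi2; apply: le_trans (expect_prod_ge _ Pi2) _.
  by rewrite subr_ge0 expR_le1 oppr_le0 s0 lerBlDr lerDl expR_ge0.
apply: ler_expect => // S; rewrite /subset_count mulr_sumr -sumrN expR_sum.
by apply: ler_prod => a _; rewrite -expRN_indic expR_ge0 lexx.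
Qed.

Lemma prob0_ge : Pi <= 2^-1 ->
  expR (- ((1 + 2 * Pi) * mu)) <= prob p (fun S => X S == 0).
Proof.
move=> Pi2; have := expect_prod_ge (_ : 0 <= 1 <= 1) Pi2.
rewrite ler01 lexx => /(_ isT).
rewrite expr1n !mulr1 -{1}[mu]mul1r -mulrDl => /le_trans; apply.
rewrite prob_expect; apply: ler_expect => // S.
case: (eqVneq (X S) 0) => [_|X0] /=.
  apply: prodr_ile1 => a _; have /andP[] := indic01 a S; rewrite mul1r; lra.
have /existsP[a aS] : [exists a, Q a \subset S].
  apply: contraNT X0 => /existsPn nQ; apply/eqP/big1 => a _.
  by rewrite /indic (negbTE (nQ a)).
by rewrite (bigD1 a)//= /indic aS mulr1 subrr mul0r.
Qed.

Section Conditioning.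
Variable a : Xi.

(** Conditioned on containing [Q a], the random subset still has independent elements; these are
    their probabilities. *)
Definition cond_p i : R := if i \in Q a then 1 else p i.

Lemma cond_p01 i : 0 <= cond_p i <= 1.
Proof. by rewrite /cond_p; case: ifP; rewrite ?ler01 ?lexx. Qed.

(** Under [cond_p] a set missing an element of [Q a] has weight 0. The product form avoids dividing
    by [expect p (Ind a)], which may be 0. *)
Lemma expect_cond f :
  expect p (fun S => Ind a S * f S) = expect p (Ind a) * expect cond_p f.
Proof.
have -> : expect p (Ind a) = \prod_(i in Q a) p i.
  by rewrite -prob_subset prob_expect.
rewrite /expect mulr_sumr; apply: eq_bigr => S _; rewrite !mulrA; congr (_ * _).
rewrite /indic /subset_weight.
case: (boolP (Q a \subset S)) => [QS|/subsetPn[i iQ iS]]; last first.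
  have -> : \prod_(j in ~: S) (1 - cond_p j) = 0.
    by rewrite (bigD1 i) ?inE//= /cond_p iQ subrr mul0r.
  by rewrite !mulr0.
rewrite mulr1; congr (_ * _).
  rewrite !(big_setID (A := S) (Q a)) (setIidPr QS) /=.
  rewrite [\prod_(i in Q a) cond_p i]big1 ?mul1r; last first.
    by move=> i iQ; rewrite /cond_p iQ.
  congr (_ * _); apply: eq_bigr => i; rewrite inE => /andP[/negbTE iQ _].
  by rewrite /cond_p iQ.
apply: eq_bigr => i; rewrite inE => iS; rewrite /cond_p ifN//.
by apply: contra iS => /(subsetP QS).
Qed.

End Conditioning.

(* The conditional form of Harris' inequality separates the variables meeting
   [Q a] from the others, which are independent of [Ind a]. *)
Lemma expect_indic_laplace_ge (s : R) a : 0 <= s ->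
  expR (- s) * (expect p (Ind a)
     - s * \sum_(b | dependent Q a b) expect p (fun S => Ind a S * Ind b S))
    * laplace s
  <= expect p (fun S => Ind a S * expR (- (s * X S))).
Proof.
move=> s0.
pose near b := (b == a) || dependent Q a b.
pose Y S := \sum_(b | near b) Ind b S.
pose Z S := \sum_(b | ~~ near b) Ind b S.
have XYZ S : X S = Y S + Z S by rewrite /subset_count (bigID near).
have sum_decr (P : pred Xi) :
    nonincreasing_set (fun S => expR (- (s * \sum_(b | P b) Ind b S))).
  move=> S S' SS'; rewrite ler_expR lerN2 ler_wpM2l//.
  by apply: ler_sum => b _; exact: indic_nondecreasing.
under [leRHS]eq_expect => S do rewrite XYZ mulrDr opprD expRD.
rewrite expect_cond.
have e0 := expect_indic_ge0 Q p01 a.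
apply: le_trans (ler_wpM2l e0 (harris (cond_p01 a) (sum_decr _) (sum_decr _))).
rewrite mulrA -expect_cond.
have -> : expect (cond_p a) (fun S => expR (- (s * Z S)))
          = expect p (fun S => expR (- (s * Z S))).
  apply: eq_expect_insensitive => i; rewrite /cond_p.
  case: ifP => // iQ _ S S' eqS; congr (expR (- (s * _))).
  apply: eq_bigr => b; rewrite negb_or /dependent => /andP[ba].
  rewrite eq_sym ba /= negbK => /eqP QQ; rewrite /indic.
  have iQb : i \notin Q b.
    by apply/negP => iQb; have := in_set0 i; rewrite -QQ inE iQ iQb.
  have subD (T : {set Gamma}) : (Q b \subset T) = (Q b \subset T :\ i).
    by rewrite subsetD1 iQb andbT.
  by rewrite subD eqS -subD.
have L0 : 0 <= laplace s by apply: expect_ge0 => // S; exact: expR_ge0.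
(* As [Z] is at most [X], its Laplace transform is at least [laplace s]. *)
apply: (le_trans (y := expect p (fun S => Ind a S * expR (- (s * Y S)))
                       * laplace s)); last first.
  apply: ler_wpM2l.
    apply: expect_ge0 => // S.
    by rewrite mulr_ge0 ?expR_ge0//; case/andP: (indic01 a S).
  apply: ler_expect => // S; rewrite ler_expR lerN2 ler_wpM2l// XYZ lerDr.
  by apply: sumr_ge0 => b _; case/andP: (indic01 b S).
apply: ler_wpM2r => //.
rewrite -expect_sum -mulNr -expectZ -expectD -expectZ.
apply: ler_expect => // S; rewrite -mulr_sumr.
(* If [Q a \subset S], then [Y S] is 1 plus the sum [W] over dependent indices, and
   [expR (- (s * W))] is at least [1 - s * W]. *)
have -> : Y S = Ind a S + \sum_(b | dependent Q a b) Ind b S.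
  rewrite /Y (bigD1 a) /near ?eqxx//=; congr (_ + _); apply: eq_bigl => b.
  by rewrite /dependent [a == b]eq_sym; case: (b == a); rewrite ?andbT.
set W := \sum_(b | _) _.
rewrite /indic; case: (_ \subset _); rewrite ?mul0r ?mulr0 ?addr0 ?mulr0//.
rewrite !mul1r [s * _]mulrDr mulr1 opprD expRD ler_wpM2l ?expR_ge0// mulNr.
exact: expR_ge1Dx.
Qed.

Lemma is_derive_laplace (t : R) :
  is_derive t 1 laplace (- expect p (fun S => X S * expR (- (t * X S)))).
Proof.
rewrite /expect -sumrN.
apply: is_derive_sum_fin => S.
have cD : is_derive t 1 ((fun y => expR (- y)) \o (X S \*: @id R))
    (- expR (- (X S * t)) * X S).
  apply: is_derive1_comp; first exact: is_derive_expRN.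
  by apply: is_derive_eq; rewrite /GRing.scale /= mulr1.
have -> : (fun y => subset_weight p S * expR (- (y * X S)))
    = subset_weight p S \*: ((fun y => expR (- y)) \o (X S \*: @id R)).
  by apply/funext => y; rewrite !fctE /= /GRing.scale /= [X S * y]mulrC.
by apply: is_derive_eq; rewrite /GRing.scale /= [X S * t]mulrC; ring.
Qed.

(** The right side is minus the derivative of [laplace]. Summing [expect_indic_laplace_ge] over [a]
    makes the single terms add up to [mu] and the dependent pairs to [delta * mu]. *)
Lemma laplace_derivative_le (t : R) : 0 <= t ->
  mu * expR (- t) * (1 - delta * t) * laplace t
  <= expect p (fun S => X S * expR (- (t * X S))).
Proof.
move=> t0.
under eq_expect => S do rewrite mulr_suml.
rewrite expect_sum.
apply: le_trans (ler_sum _ (fun a _ => expect_indic_laplace_ge a t0)).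
rewrite -mulr_suml -mulr_sumr sumrB -mu_sum -mulr_sumr.
have -> : \sum_a \sum_(b | dependent Q a b)
    expect p (fun S => Ind a S * Ind b S) = delta * mu.
  have := Lambda_delta Q p01; rewrite /Lambda mulrDl mul1r.
  by move/addrI <-; rewrite pair_big_dep.
rewrite le_eqVlt; apply/orP; left; apply/eqP; ring.
Qed.

(** A Gronwall argument: [K] is the exponent on the right, and [laplace_derivative_le] says that
    [laplace t * expR (- K t)] has nonpositive derivative; its value at 0 is 1. *)
Lemma laplace_le (s : R) : 0 <= s ->
  laplace s <= expR (mu * (- (1 - expR (- s))
                           + delta * (1 - (1 + s) * expR (- s)))).
Proof.
move=> s0.
pose K t : R := mu * (- (1 - expR (- t)) + delta * (1 - (1 + t) * expR (- t))).
pose K' t : R := - (mu * expR (- t) * (1 - delta * t)).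
have KD (t : R) : is_derive t 1 K (K' t).
  have eD := is_derive_expRN t.
  have -> : K = mu \*: (((fun y => expR (- y)) - cst 1)
      + delta \*: (cst 1 - (cst 1 + id) * (fun y => expR (- y)))).
    by apply/funext => y; rewrite /K !fctE /= /GRing.scale /=; ring.
  by apply: is_derive_eq; rewrite /K' /= !fctE /= /GRing.scale /=; ring.
have ND (t : R) : is_derive t 1 (fun y => expR (- K y)) (- expR (- K t) * K' t).
  exact: (is_derive1_comp (f := fun y => expR (- y)) (is_derive_expRN _) (KD t)).
have GD t := is_deriveM (is_derive_laplace t) (ND t).
have := le_at0_derive GD _ s0.
rewrite !fctE /=.
have K0 : K 0 = 0 by rewrite /K oppr0 expR0; ring.
have L0 : laplace 0 = 1.
  rewrite /laplace; under eq_expect => S do rewrite mul0r oppr0 expR0.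
  exact: expect_cst.
rewrite K0 L0 oppr0 expR0 mulr1 expRN ler_pdivrMr ?expR_gt0// mul1r; apply.
move=> t t0; rewrite /GRing.scale /=.
have := ler_wpM2l (expR_ge0 (- K t)) (laplace_derivative_le t0).
rewrite /K'; lra.
Qed.

End Laplace.

(** * The Poisson rate function *)

Section Rate.
Variable R : realType.
Implicit Types (u v w z s : R).

Definition rate u := u * ln u + 1 - u.

Lemma phiN_rate (x : R) : x < 1 -> phi (- x) = rate (1 - x).
Proof.
by move=> x1; rewrite /phi eqr_opp lt_eqF// /rate; ring.
Qed.

(** This and the next lemma are bounds on [ln z] and [rate z] written in the variable [s = - ln z],
    in which all functions are smooth on the whole line. *)
Lemma le_quadratic_of_expRN s : 0 <= s ->
  1 - expR (- s) + (1 - expR (- s)) ^+ 2 / 2 <= s.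
Proof.
move=> s0.
pose e y : R := expR (- y).
pose f y : R := 1 - e y + (1 - e y) ^+ 2 / 2 - y.
have fD (t : R) : is_derive t 1 f (- (1 - e t) ^+ 2).
  have eD := is_derive_expRN t.
  have -> : f = cst 1 - e + 2^-1 \*: ((cst 1 - e) * (cst 1 - e)) - id.
    by apply/funext => y; rewrite /f !fctE /= /GRing.scale /=; field.
  by apply: is_derive_eq; rewrite !fctE /= /GRing.scale /= -/(e t); field.
have f0 : f 0 = 0 by rewrite /f /e oppr0 expR0; field.
have := le_at0_derive fD _ s0; rewrite f0 subr_le0; apply => t t0.
by rewrite oppr_le0 sqr_ge0.
Qed.

Lemma ge_quadratic_of_expRN s : 0 <= s ->
  (1 - expR (- s)) ^+ 2 / 2 <= 1 - (1 + s) * expR (- s).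
Proof.
move=> s0.
pose e y : R := expR (- y).
pose f y : R := (1 - e y) ^+ 2 / 2 - (1 - (1 + y) * e y).
have fD (t : R) : is_derive t 1 f (e t * (1 - e t - t)).
  have eD := is_derive_expRN t.
  have -> : f = 2^-1 \*: ((cst 1 - e) * (cst 1 - e))
                - (cst 1 - (cst 1 + id) * e).
    by apply/funext => y; rewrite /f !fctE /= /GRing.scale /=; field.
  by apply: is_derive_eq; rewrite !fctE /= /GRing.scale /= -/(e t); field.
have f0 : f 0 = 0 by rewrite /f /e oppr0 expR0; field.
have := le_at0_derive fD _ s0; rewrite f0 subr_le0; apply => t t0.
rewrite pmulr_rle0 ?expR_gt0//; have := expR_ge1Dx (- t); rewrite /e; lra.
Qed.

Lemma ln_le_quadratic z : 0 < z <= 1 -> ln z <= - (1 - z + (1 - z) ^+ 2 / 2).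
Proof.
move=> /andP[z0 z1]; have := @le_quadratic_of_expRN (- ln z).
by rewrite oppr_ge0 ln_le0// opprK lnK ?posrE// => /(_ isT); lra.
Qed.

Lemma rate_ge z : 0 < z <= 1 -> (1 - z) ^+ 2 / 2 <= rate z.
Proof.
move=> /andP[z0 z1]; have := @ge_quadratic_of_expRN (- ln z).
rewrite oppr_ge0 ln_le0// opprK lnK ?posrE// => /(_ isT).
by rewrite /rate; lra.
Qed.

Lemma ln_leB1 z : 0 < z -> ln z <= z - 1.
Proof.
by move=> z0; have := @le_ln1Dx R (z - 1); rewrite [1 + _]addrC subrK; apply; lra.
Qed.

Lemma rate_le z : 0 < z -> rate z <= (1 - z) ^+ 2.
Proof.
by move=> z0; have := ler_wpM2l (ltW z0) (ln_leB1 z0); rewrite /rate expr2; lra.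
Qed.

Lemma rate_ge0 z : 0 < z <= 1 -> 0 <= rate z.
Proof.
by move=> /rate_ge; apply: le_trans; rewrite divr_ge0 ?sqr_ge0.
Qed.

(** The right side is the relative entropy of Poisson laws with means [u] and [v]. Dividing by [u]
    reduces the bound to [ln_le_quadratic] at [v / u]; the companion below uses [rate_ge] at
    [w / v]. *)
Lemma rel_entropy_ge_l u v : 0 < v <= u ->
  (u - v) ^+ 2 / (2 * u) <= u * (ln u - ln v) - u + v.
Proof.
move=> /andP[v0 vu]; have u0 : 0 < u by exact: lt_le_trans vu.
have := @ln_le_quadratic (v / u).
rewrite divr_gt0// ler_pdivrMr// mul1r vu => /(_ isT).
rewrite ln_div ?posrE// => /(ler_wpM2l (ltW u0)).
suff -> : u * - (1 - v / u + (1 - v / u) ^+ 2 / 2)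
   = - (u - v) - (u - v) ^+ 2 / (2 * u) by lra.
by field; rewrite gt_eqF.
Qed.

Lemma rel_entropy_ge_r v w : 0 < w <= v ->
  (v - w) ^+ 2 / (2 * v) <= w * (ln w - ln v) - w + v.
Proof.
move=> /andP[w0 wv]; have v0 : 0 < v by exact: lt_le_trans wv.
have := @rate_ge (w / v).
rewrite divr_gt0// ler_pdivrMr// mul1r wv => /(_ isT).
rewrite /rate ln_div ?posrE// => /(ler_wpM2l (ltW v0)).
have -> : v * ((1 - w / v) ^+ 2 / 2) = (v - w) ^+ 2 / (2 * v).
  by field; rewrite gt_eqF.
move=> /le_trans; apply; rewrite le_eqVlt; apply/orP; left; apply/eqP.
by field; rewrite gt_eqF.
Qed.

Lemma ln_ge_sqrt z : 0 < z -> - (2 * (z^-1 - 1)) <= ln (z ^+ 2).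
Proof.
move=> z0; have := ln_leB1 (_ : 0 < z^-1).
by rewrite invr_gt0 => /(_ z0); rewrite lnV ?posrE// lnXn//; lra.
Qed.

(** Needed near 0, where [rate] tends to 1 but the quadratic lower bound [rate_ge] gives only one
    half. *)
Lemma rate_ge_sqrt z : 0 < z -> 1 - 2 * z <= rate (z ^+ 2).
Proof.
move=> z0; have := ler_wpM2l (sqr_ge0 z) (ln_ge_sqrt z0).
have -> : z ^+ 2 * - (2 * (z^-1 - 1)) = 2 * z ^+ 2 - 2 * z.
  by field; rewrite gt_eqF.
have := sqr_ge0 z; rewrite /rate; lra.
Qed.

(** A first-order expansion: [ln] is the derivative of [rate], and the error [h ^+ 2 / u] comes from
    [ln_leB1] at [(u - h) / u]. *)
Lemma rate_sub_le u h : 0 < h < u ->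
  rate (u - h) <= rate u + h ^+ 2 / u - h * ln u.
Proof.
move=> /andP[h0 hu]; have u0 : 0 < u by exact: lt_trans hu.
have w0 : 0 < u - h by lra.
have := ln_leB1 (_ : 0 < (u - h) / u); rewrite divr_gt0// => /(_ isT).
rewrite ln_div ?posrE// => /(ler_wpM2l (ltW w0)).
have -> : (u - h) * ((u - h) / u - 1) = h ^+ 2 / u - h.
  by field; rewrite gt_eqF.
rewrite /rate; lra.
Qed.

End Rate.

(** * The lower tail by exponential tilting *)

Section Tilting.
Variables (R : realType) (Gamma Xi : finType).
Variables (p : Gamma -> R) (Q : Xi -> {set Gamma}).
Hypothesis p01 : forall i, 0 <= p i <= 1.

Local Notation X := (subset_count R Q).
Local Notation mu := (mu p Q).
Local Notation delta := (delta p Q).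
Local Notation Pi := (max_prob p Q).
Local Notation F := (laplace p Q).

(** The bound holds pointwise before taking expectations: above [b] the first subtracted term
    outweighs the tilted weight [expR (- (s * x))], up to [a] the second one does, and in between
    [expR (s * (a - x))] is at most 1. *)
Lemma prob_tilt (s t t' a b : R) : 0 <= s -> 0 <= t -> 0 <= t' ->
  expR (s * a) * (F s - expR (- (t * b)) * F (s - t)
                  - expR (t' * a) * F (s + t'))
  <= prob p (fun S => X S <= b).
Proof.
move=> s0 t0 t'0.
rewrite /laplace -!mulNr -!expectZ -!expectD -expectZ prob_expect.
apply: ler_expect => // S; set x := X S.
rewrite !mulNr -!expRD.
have [xb|bx] := leP x b => /=; last first.
  rewrite pmulr_rle0 ?expR_gt0// -addrA -opprD subr_le0.
  rewrite (le_trans (y := expR (- (t * b) - (s - t) * x)))//; last first.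
    by rewrite lerDl expR_ge0.
  rewrite ler_expR; have := ler_wpM2l t0 (ltW bx); lra.
have [xa|ax] := leP x a.
  rewrite (le_trans (y := 0))// pmulr_rle0 ?expR_gt0// addrAC.
  rewrite (le_trans (y := expR (- (s * x)) - expR (t' * a - (s + t') * x)))//.
    by rewrite gerDl oppr_le0 expR_ge0.
  rewrite subr_le0 ler_expR; have := ler_wpM2l t'0 xa; lra.
rewrite (le_trans (y := expR (s * a) * expR (- (s * x))))//.
  rewrite ler_wpM2l ?expR_ge0// -addrA -opprD gerDl oppr_le0.
  by rewrite addr_ge0 ?expR_ge0.
rewrite -expRD expR_le1; have := ler_wpM2l s0 (ltW ax); lra.
Qed.

Lemma laplace_ln_le z : 0 < z <= 1 ->
  F (- ln z) <= expR (mu * (- (1 - z) + delta * rate z)).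
Proof.
move=> /andP[z0 z1]; have := laplace_le Q p01 (_ : 0 <= - ln z).
rewrite oppr_ge0 ln_le0// => /(_ isT) /le_trans; apply.
rewrite opprK lnK ?posrE// ler_expR le_eqVlt; apply/orP; left; apply/eqP.
by rewrite /rate; ring.
Qed.

Lemma prob_lower_tail_ge (eta u d : R) :
    0 < d -> 2 * d < u -> u <= 1 ->
    Pi <= 2^-1 -> Pi <= eta -> delta <= eta ->
    2 <= mu * (d ^+ 2 / 2 - 3 * eta * (1 - u + 2 * d) ^+ 2) ->
  expR (- (1 + mu * ((1 + 4 * eta) * rate (u - 2 * d))))
  <= prob p (fun S => X S <= u * mu).
Proof.
move=> d0 du u1 Pi2 Pie dele big.
pose v := u - d; pose w := u - 2 * d; pose q := (1 - w) ^+ 2.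
have [w0 wv vu] : [/\ 0 < w, w < v & v < u] by split; rewrite /w/v; lra.
have v0 : 0 < v by exact: lt_trans wv.
have u0 : 0 < u by exact: lt_trans vu.
have v1 : v <= 1 by lra.
have mu0 : 0 <= mu by exact: mu_ge0.
have Pi0 : 0 <= Pi by exact: max_prob_ge0.
have del0 : 0 <= delta by exact: delta_ge0.
have lvu : ln v <= ln u by rewrite ler_ln ?posrE// ltW.
have lwv : ln w <= ln v by rewrite ler_ln ?posrE// ltW.
have s0 : 0 <= - ln v by rewrite oppr_ge0 ln_le0.
have rate_q z : w <= z <= 1 -> rate z <= q.
  move=> /andP[wz z1]; have z0 : 0 < z by exact: lt_le_trans wz.
  by apply: le_trans (rate_le z0) _; rewrite ler_sqr ?nnegrE; lra.
have vq : (1 - v) ^+ 2 <= q by rewrite ler_sqr ?nnegrE; lra.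
have q0 : 0 <= q by exact: sqr_ge0.
have {}big : 2 <= mu * (d ^+ 2 / 2 - 3 * (eta * q)).
  by move: big; rewrite /q /w (_ : 1 - (u - 2 * d) = 1 - u + 2 * d) ?mulrA//; ring.
have d_div z : 0 < z <= 1 -> d ^+ 2 / 2 <= d ^+ 2 / (2 * z).
  move=> /andP[z0 z1]; rewrite ler_wpM2l ?sqr_ge0// lef_pV2 ?posrE; lra.
have := laplace_ge p01 s0 Pi2; rewrite opprK lnK ?posrE//.
set L := F _ => Lge.
(* Each tail may take a quarter of [L]. The gain [d ^+ 2 / 2] meets an error of [eta * q] from the
   upper bound at [z] and [2 * (eta * q)] from the lower bound at [v]; by [big] an exponent of 2
   remains, and [4 <= expR 2]. *)
have small_term (c z : R) : w <= z <= 1 ->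
    d ^+ 2 / 2 <= (1 - z) - (1 - v) - c ->
    expR (c * mu) * F (- ln z) <= L / 4.
  move=> /andP[wz z1] cz; have z0 : 0 < z by exact: lt_le_trans wz.
  rewrite ler_pdivlMr//.
  apply: le_trans Lge.
  have e4 : (4 : R) <= expR 2.
    have -> : (2 : R) = 1 + 1 by ring.
    have := expR_ge1Dx (1 : R); rewrite expRD => e2.
    by apply: le_trans (ler_pM _ _ e2 e2); lra.
  apply: le_trans (ler_pM _ _ (ler_wpM2l (expR_ge0 _) (laplace_ln_le _)) e4) _ => //.
  - by rewrite mulr_ge0 ?expR_ge0// expect_ge0// => S; exact: expR_ge0.
  - by rewrite z0.
  rewrite -!expRD ler_expR.
  have rz : delta * rate z <= eta * q.
    by apply: ler_pM => //; [apply: rate_ge0; rewrite z0|apply: rate_q; rewrite wz].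
  have pv : Pi * (1 - v) ^+ 2 <= eta * q by apply: ler_pM => //; exact: sqr_ge0.
  have : 0 <= mu * ((1 - z) - (1 - v) - c - delta * rate z
            - 2 * (Pi * (1 - v) ^+ 2) - (d ^+ 2 / 2 - 3 * (eta * q))).
    by rewrite mulr_ge0//; lra.
  lra.
have T1 : expR (- ((ln u - ln v) * (u * mu))) * F (- ln v - (ln u - ln v))
          <= L / 4.
  rewrite (_ : - _ = - ((ln u - ln v) * u) * mu); last by ring.
  rewrite (_ : - ln v - _ = - ln u); last by ring.
  apply: small_term; first by apply/andP; split; lra.
  have := d_div u; have := @rel_entropy_ge_l R u v.
  rewrite v0 u0 u1 (ltW vu) => /(_ isT) + /(_ isT).
  rewrite (_ : u - v = d); last by rewrite /v; ring.
  lra.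
have T2 : expR ((ln v - ln w) * (w * mu)) * F (- ln v + (ln v - ln w))
          <= L / 4.
  rewrite mulrA (_ : - ln v + _ = - ln w); last by ring.
  apply: small_term; first by apply/andP; split; lra.
  have := d_div v; have := @rel_entropy_ge_r R v w.
  rewrite v0 w0 v1 (ltW wv) => /(_ isT) + /(_ isT).
  rewrite (_ : v - w = d); last by rewrite /v /w; ring.
  lra.
apply: le_trans (prob_tilt (s := - ln v) (t := ln u - ln v) (t' := ln v - ln w)
  (w * mu) _ _ _ _); rewrite ?subr_ge0//.
apply: (le_trans (y := expR (- ln v * (w * mu)) * (L / 2))); last first.
  by rewrite -/L ler_wpM2l ?expR_ge0//; lra.
(* The half of [L] that survives accounts for the additive 1 in the exponent. *)
have e2 : expR (- 1) <= (2 : R)^-1.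
  rewrite expRN lef_pV2 ?posrE ?expR_gt0//.
  by have := expR_ge1Dx (1 : R); lra.
rewrite opprD expRD [leLHS]mulrC [leRHS]mulrA.
apply: ler_pM; rewrite ?expR_ge0//.
apply: le_trans (ler_wpM2l (expR_ge0 _) Lge).
rewrite -expRD ler_expR.
(* This relative entropy is exactly [rate w - w * ln v - (1 - v)], so its sign lets [rate w] bound
   the exponent. The term [4 * eta] pays for the [Pi] error, since [q <= 2 * rate w]. *)
have Dwv : 0 <= w * (ln w - ln v) - w + v.
  apply: le_trans (rel_entropy_ge_r (_ : 0 < w <= v)); last by rewrite w0 ltW.
  by rewrite divr_ge0 ?sqr_ge0//; lra.
have qr : q <= 2 * rate w by have := @rate_ge R w; rewrite w0 -/q; lra.
have pv : Pi * (1 - v) ^+ 2 <= eta * (2 * rate w).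
  by apply: ler_pM; rewrite ?sqr_ge0//; exact: le_trans qr.
have : 0 <= mu * ((1 + 4 * eta) * rate w + - ln v * w - (1 - v)
                  - 2 * (Pi * (1 - v) ^+ 2)).
  by rewrite mulr_ge0//; move: Dwv pv; rewrite /rate; lra.
rewrite -/w; lra.
Qed.

End Tilting.

(** * Numerical inequalities behind the constant 135 *)

Section Constants.
Variable R : realType.
Implicit Types (eps ell eta u : R).

Lemma rate1B_ge eps : 0 < eps < 1 -> eps ^+ 2 / 2 <= rate (1 - eps).
Proof.
move=> /andP[e0 e1]; have /rate_ge : 0 < 1 - eps <= 1 by apply/andP; split; lra.
by rewrite (_ : 1 - (1 - eps) = eps); last by ring.
Qed.

(** By [rate_ge_sqrt] the rate is at least [1 - 8 * ell], a loss that the factor [1 + 135 * ell]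
    recovers. *)
Lemma rate_ge_of_tiny eps ell eta : 0 < eps < 1 -> 0 < ell <= 30^-1 ->
    eta <= ell -> 1 - eps <= 16 * ell ^+ 2 ->
  1 + 2 * eta <= (1 + 135 * ell) * rate (1 - eps).
Proof.
move=> /andP[e0 e1] /andP[l0 l1] etal ul.
pose z := Num.sqrt (1 - eps).
have z2 : 1 - eps = z ^+ 2 by rewrite sqr_sqrtr//; lra.
have z0 : 0 < z by rewrite sqrtr_gt0; lra.
have zl : z <= 4 * ell.
  by rewrite -ler_sqr ?nnegrE -?z2; [rewrite exprMn; lra|lra|lra].
have := rate_ge_sqrt z0; rewrite -z2 => rz.
have r8 : 1 - 8 * ell <= rate (1 - eps) by lra.
have l135 : 0 <= 1 + 135 * ell by lra.
have := ler_wpM2l l135 r8.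
have : 0 <= ell * (30^-1 - ell) by rewrite mulr_ge0; lra.
lra.
Qed.

(** The shift [h = 6 * eps * ell ^+ 2] is twice the [d] used for tilting. The two errors in
    [rate_sub_le] are at most [eps ^+ 2 * ell] and [3 * eps ^+ 2 * ell], together at most
    [8 * ell * rate u]. Stopping at 133 leaves [2 * ell] for the additive 1 of
    [prob_lower_tail_ge]. *)
Lemma rate_sub_le_of_small eps ell eta : 0 < eps < 1 -> 0 < ell <= 30^-1 ->
    0 <= eta <= ell -> 16 * ell ^+ 2 < 1 - eps ->
  (1 + 4 * eta) * rate (1 - eps - 6 * eps * ell ^+ 2)
  <= (1 + 133 * ell) * rate (1 - eps).
Proof.
move=> /andP[e0 e1] /andP[l0 l1] /andP[eta0 etal] ul.
pose u := 1 - eps; pose h := 6 * eps * ell ^+ 2.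
have u0 : 0 < u by rewrite /u; lra.
pose z := Num.sqrt u.
have z2 : u = z ^+ 2 by rewrite sqr_sqrtr// ltW.
have z0 : 0 < z by rewrite sqrtr_gt0.
have z1 : z <= 1 by rewrite -ler_sqr ?nnegrE -?z2 ?expr1n /u; lra.
have lz : 4 * ell <= z.
  by rewrite -ler_sqr ?nnegrE -?z2 /u; [rewrite exprMn; lra|lra|lra].
have l20 : 0 < ell ^+ 2 by rewrite exprn_gt0.
have h0 : 0 < h by rewrite /h !mulr_gt0.
have hl : h <= 6 * ell ^+ 2.
  have : 0 <= (1 - eps) * ell ^+ 2 by rewrite mulr_ge0; lra.
  by rewrite /h; lra.
have hu : h < u by rewrite /u; lra.
have e20 : 0 <= eps ^+ 2 by exact: sqr_ge0.
have h2u : h ^+ 2 / u <= eps ^+ 2 * ell.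
  rewrite ler_pdivrMr//.
  have -> : h ^+ 2 = eps ^+ 2 * ell * (36 * ell * ell ^+ 2) by rewrite /h; ring.
  apply: ler_wpM2l; first by rewrite mulr_ge0// ltW.
  have : 0 <= (30^-1 - ell) * ell ^+ 2 by rewrite mulr_ge0; lra.
  by rewrite /u; lra.
have hln : - (h * ln u) <= eps ^+ 2 * (3 * ell).
  have lnu : - ln u <= eps / (2 * ell).
    have := ln_ge_sqrt z0; rewrite -z2.
    suff : 2 * (z^-1 - 1) <= eps / (2 * ell) by lra.
    have zV : z^-1 - 1 <= eps / z.
      rewrite ler_pdivlMr// mulrBl mulVf ?gt_eqF// mul1r.
      have : 0 <= z * (1 - z) by rewrite mulr_ge0; lra.
      by move: z2; rewrite /u expr2; lra.
    have : eps / z <= eps / (4 * ell).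
      by rewrite ler_pM2l// lef_pV2 ?posrE//; lra.
    have -> : eps / (2 * ell) = 2 * (eps / (4 * ell)) by field; rewrite gt_eqF.
    lra.
  rewrite -mulrN; apply: le_trans (ler_wpM2l (ltW h0) lnu) _.
  rewrite le_eqVlt; apply/orP; left; apply/eqP.
  by rewrite /h; field; rewrite gt_eqF.
have := @rate_sub_le R u h; rewrite h0 hu => /(_ isT).
move=> rsub; have ru : eps ^+ 2 / 2 <= rate u by apply: rate1B_ge; rewrite e0.
have ru0 : 0 <= rate u by lra.
have : rate (u - h) <= (1 + 8 * ell) * rate u.
  have := ler_wpM2l (ltW l0) ru; lra.
move=> /(ler_wpM2l (_ : 0 <= 1 + 4 * eta)) H.
apply: le_trans (H _) _; first by lra.
rewrite mulrA ler_wpM2r//.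
have := ler_pM eta0 (ltW l0) etal l1; lra.
Qed.

Lemma rate_ge_of_large eps ell eta : 0 < eps < 1 -> 30^-1 <= ell <= 1 ->
    eta <= 2 ^- 14 -> 1 - eps <= 6 * eps * ell ^+ 2 ->
  1 + 2 * eta <= (1 + 135 * ell) * rate (1 - eps).
Proof.
move=> /andP[e0 e1] /andP[l0 l1] eta14 ul.
have eta' : 2 * eta <= 10^-1 ^+ 3.
  by move: eta14; rewrite !exprS !expr0; lra.
have e7 : 7^-1 <= eps.
  have : eps * ell ^+ 2 <= eps by rewrite ler_piMr ?(ltW e0)// expr_le1//; lra.
  by rewrite -mulrA in ul; lra.
have re : eps ^+ 2 / 2 <= rate (1 - eps) by apply: rate1B_ge; rewrite e0.
apply: (le_trans (y := (1 + 135 * ell) * (eps ^+ 2 / 2))); last first.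
  by rewrite ler_wpM2l//; lra.
have [e9|e9] := leP (9 / 10) eps.
  have ee : 9 / 10 * (9 / 10) <= eps ^+ 2 by rewrite expr2 ler_pM; lra.
  have : 11 / 2 * (4 / 10) <= (1 + 135 * ell) * (eps ^+ 2 / 2) by rewrite ler_pM; lra.
  lra.
(* Squaring [y] brings in [ell ^+ 2], which [ul] bounds below. The factor [759 + 3 / 8] is 135
   squared over 24, and it exceeds 686 by enough to give [y1]. *)
pose y := 135 * ell * (eps ^+ 2 / 2).
have y2 : y ^+ 2 = 6 * eps * ell ^+ 2 * eps ^+ 3 * (759 + 3 / 8).
  by rewrite /y; field.
have e3 : 686^-1 <= (1 - eps) * eps ^+ 3.
  have [e2|e2] := leP eps 2^-1.
    have : 7^-1 ^+ 3 <= eps ^+ 3 by rewrite lerXn2r ?nnegrE; lra.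
    move=> c7; rewrite (_ : 686^-1 = 2^-1 * 7^-1 ^+ 3 :> R); last by field.
    by apply: ler_pM => //; lra.
  have : 2^-1 ^+ 3 <= eps ^+ 3 by rewrite lerXn2r ?nnegrE; lra.
  move=> c2; rewrite (le_trans (y := 10^-1 * 2^-1 ^+ 3))//; first by lra.
  by apply: ler_pM => //; lra.
have eps3 : 0 <= eps ^+ 3 by rewrite exprn_ge0// ltW.
have y0 : 0 <= y by rewrite /y !mulr_ge0 ?sqr_ge0//; lra.
have y1 : 1 + 10^-1 ^+ 3 <= y.
  rewrite -ler_sqr ?nnegrE//; last by lra.
  have := ler_wpM2r eps3 ul; rewrite y2; lra.
have := sqr_ge0 eps; move: y1; rewrite /y; lra.
Qed.

(** The crude bounds [rate_le] and [rate1B_ge] lose a factor 2, affordable here because [133 * ell]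
    is at least [133 / 30]. *)
Lemma rate_sub_le_of_large eps ell eta : 0 < eps < 1 -> 30^-1 <= ell <= 1 ->
    0 <= eta <= 2 ^- 14 -> 6 * eps * ell ^+ 2 < 1 - eps ->
  (1 + 4 * eta) * rate (1 - eps - 6 * eps * ell ^+ 2)
  <= (1 + 133 * ell) * rate (1 - eps).
Proof.
move=> /andP[e0 e1] /andP[l0 l1] /andP[eta0 eta14] ul.
have eta' : 4 * eta <= 10^-1 ^+ 3.
  by move: eta14; rewrite !exprS !expr0; lra.
have re : eps ^+ 2 / 2 <= rate (1 - eps) by apply: rate1B_ge; rewrite e0.
have := @rate_le R (1 - eps - 6 * eps * ell ^+ 2).
rewrite subr_gt0 ul => /(_ isT).
rewrite (_ : 1 - (1 - eps - _) = eps * (1 + 6 * ell ^+ 2)); last by ring.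
rewrite exprMn => rw.
have e20 : 0 < eps ^+ 2 by rewrite exprn_gt0.
apply: le_trans (ler_wpM2l _ rw) _; first by lra.
apply: (le_trans (y := (1 + 133 * ell) * (eps ^+ 2 / 2))); last first.
  by rewrite ler_wpM2l//; lra.
rewrite mulrCA [leRHS]mulrCA ler_pM2l//.
have l2 : ell ^+ 2 <= ell by rewrite ler_iXnr//; lra.
have l4 : ell ^+ 4 <= ell by rewrite ler_iXnr//; lra.
have sq : (1 + 6 * ell ^+ 2) ^+ 2 <= 1 + 48 * ell.
  have -> : (1 + 6 * ell ^+ 2) ^+ 2 = 1 + 12 * ell ^+ 2 + 36 * ell ^+ 4 by ring.
  lra.
have eta1 : 1 + 4 * eta <= 1 + 10^-1 ^+ 3 by lra.
have : (1 + 4 * eta) * (1 + 6 * ell ^+ 2) ^+ 2 <= (1 + 10^-1 ^+ 3) * (1 + 48 * ell).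
  by apply: ler_pM; rewrite ?sqr_ge0//; lra.
lra.
Qed.

End Constants.

(** * Choice of parameters and the final bound *)

Section LowerTail.
Variables (R : realType) (Gamma Xi : finType).
Variables (p : Gamma -> R) (Q : Xi -> {set Gamma}).
Hypothesis p01 : forall i, 0 <= p i <= 1.

Local Notation X := (subset_count R Q).
Local Notation mu := (mu p Q).
Local Notation delta := (delta p Q).
Local Notation Pi := (max_prob p Q).

Lemma prob_le_ge_prob0 (c b : R) : 0 <= b -> Pi <= 2^-1 ->
  1 + 2 * Pi <= c -> expR (- (c * mu)) <= prob p (fun S => X S <= b).
Proof.
move=> b0 Pi2 cP.
have m0 : 0 <= mu by exact: mu_ge0.
apply: (le_trans (y := expR (- ((1 + 2 * Pi) * mu)))).
  by rewrite ler_expR lerN2 ler_wpM2r.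
apply: le_trans (prob0_ge p01 Pi2) _.
rewrite !prob_expect; apply: ler_expect => // S.
by case: eqVneq => [->|_]; rewrite ?b0.
Qed.

Lemma prob_lower_tail_lt1 (eps ell eta : R) :
    0 < eps < 1 -> 0 < ell <= 1 -> Pi <= eta -> delta <= eta ->
    eta <= 2 ^- 14 -> eta <= ell ^+ 8 -> 1 <= eps ^+ 2 * mu * ell ^+ 4 ->
  expR (- ((1 + 135 * ell) * rate (1 - eps) * mu))
  <= prob p (fun S => X S <= (1 - eps) * mu).
Proof.
move=> e01 l01 Pie de e14 e8 big.
have [[e0 e1] [l0 l1]] := (andP e01, andP l01).
have m0 : 0 <= mu by exact: mu_ge0.
have Pi0 : 0 <= Pi := max_prob_ge0 p Q.
have eta0 : 0 <= eta by exact: le_trans Pie.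
have etal : eta <= ell by rewrite (le_trans e8)// ler_iXnr// ltW.
have Pi2 : Pi <= 2^-1.
  by move: e14; rewrite !exprS !expr0; lra.
have uge0 : 0 <= (1 - eps) * mu by rewrite mulr_ge0//; lra.
have empty : 1 + 2 * eta <= (1 + 135 * ell) * rate (1 - eps) ->
    expR (- ((1 + 135 * ell) * rate (1 - eps) * mu))
    <= prob p (fun S => X S <= (1 - eps) * mu).
  by move=> H; apply: prob_le_ge_prob0 => //; lra.
have tilt : 6 * eps * ell ^+ 2 < 1 - eps ->
    (1 + 4 * eta) * rate (1 - eps - 6 * eps * ell ^+ 2)
    <= (1 + 133 * ell) * rate (1 - eps) ->
    expR (- ((1 + 135 * ell) * rate (1 - eps) * mu))
    <= prob p (fun S => X S <= (1 - eps) * mu).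
  move=> du rw.
  have l20 : 0 < ell ^+ 2 by rewrite exprn_gt0.
  have l40 : 0 < ell ^+ 4 by rewrite exprn_gt0.
  have d2 : 2 * (3 * eps * ell ^+ 2) = 6 * eps * ell ^+ 2 by ring.
  (* With [d = 3 * eps * ell ^+ 2], the quantity [1 - u + 2 * d] equals
     [eps * (1 + 6 * ell ^+ 2)]. *)
  have := @prob_lower_tail_ge R Gamma Xi p Q p01 eta (1 - eps) (3 * eps * ell ^+ 2).
  rewrite d2 !mulr_gt0// du gerBl (ltW e0) Pi2 Pie de.
  move=> /(_ isT isT isT isT isT isT) H.
  apply: le_trans (H _).
    rewrite ler_expR lerN2.
    have re : eps ^+ 2 / 2 <= rate (1 - eps) by apply: rate1B_ge; rewrite e0.
    have l4l : ell ^+ 4 <= ell by rewrite ler_iXnr// ltW.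
    (* The additive 1 is absorbed by the difference between 135 and 133. *)
    have one : 1 <= 2 * ell * (mu * rate (1 - eps)).
      have H1 : 0 <= mu * (rate (1 - eps) - eps ^+ 2 / 2) by rewrite mulr_ge0//; lra.
      have H2 : 0 <= mu * eps ^+ 2 * (ell - ell ^+ 4).
        by rewrite !mulr_ge0 ?sqr_ge0//; lra.
      have := mulr_ge0 (ltW l0) H1; lra.
    have := ler_wpM2l m0 rw; lra.
  (* The geometric mean of the bounds [e14] and [e8]. It keeps [3 * 49 * eta] below
     [3 / 2 * ell ^+ 4], so at least 3 of the [9 / 2] in [d ^+ 2 / 2] remain. *)
  have eta4 : eta <= ell ^+ 4 / 128.
    rewrite -ler_sqr ?nnegrE//; last by rewrite divr_ge0 ?ltW.
    have := ler_pM eta0 eta0 e14 e8.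
    by rewrite -expr2 => /le_trans; apply; rewrite le_eqVlt; apply/orP; left;
      apply/eqP; rewrite !exprS !expr0; field.
  have q49 : (1 + 6 * ell ^+ 2) ^+ 2 <= 49.
    have -> : (49 : R) = 7 ^+ 2 by ring.
    have : ell ^+ 2 <= 1 by rewrite exprn_ile1// ltW.
    by move=> ?; rewrite ler_sqr ?nnegrE; lra.
  have := ler_pM eta0 (sqr_ge0 _) eta4 q49 => etaq.
  set g := _ / 2 - _.
  have -> : g = eps ^+ 2 * (9 / 2 * ell ^+ 4 - 3 * (eta * (1 + 6 * ell ^+ 2) ^+ 2)).
    by rewrite /g; field.
  rewrite (le_trans (y := 3 * (eps ^+ 2 * mu * ell ^+ 4)))//; first by lra.
  have : 0 <= eps ^+ 2 * mu
    * (9 / 2 * ell ^+ 4 - 3 * (eta * (1 + 6 * ell ^+ 2) ^+ 2) - 3 * ell ^+ 4).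
    by rewrite !mulr_ge0 ?sqr_ge0//; lra.
  lra.
have [lsmall|llarge] := leP ell 30^-1.
  have [ul|ul] := leP (1 - eps) (16 * ell ^+ 2).
    by apply: empty; apply: rate_ge_of_tiny; rewrite ?l0.
  apply: tilt; last by apply: rate_sub_le_of_small; rewrite ?l0 ?eta0.
  have : 0 <= (1 - eps) * ell ^+ 2 by rewrite mulr_ge0 ?sqr_ge0//; lra.
  by have := sqr_ge0 ell; lra.
have [ul|ul] := leP (1 - eps) (6 * eps * ell ^+ 2).
  by apply: empty; apply: rate_ge_of_large; rewrite ?(ltW llarge).
by apply: tilt => //; apply: rate_sub_le_of_large; rewrite ?(ltW llarge) ?eta0.
Qed.

End LowerTail.

Theorem theorem1 (R : realType) (Gamma Xi : finType) (p : Gamma -> R)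
    (Q : Xi -> {set Gamma}) (eps : R)
    (p01 : forall i : Gamma, 0 <= p i <= 1)
    (Xi_nonempty : (0 < #|Xi|)%N)
    (eps01 : 0 <= eps <= 1)
    (small : Num.max (max_prob p Q) ((eps < 1)%R%:R * delta p Q) <= 2 ^- 14)
    (large : (eps < 1)%R%:R <= eps ^+ 2 * mu p Q) :
  expR (- ((1 + xi p Q eps) * phi (- eps) * mu p Q))
    <= prob p (fun S => subset_count R Q S <= (1 - eps) * mu p Q).
Proof.
have Pi0 := max_prob_ge0 p Q.
have two14 : 2 ^- 14 <= 2^-1 :> R by rewrite !exprS !expr0; lra.
have powR8 (x : R) : 0 <= x -> (x `^ 8^-1) ^+ 8 = x.
  by move=> x0; rewrite -powR_mulrn ?powR_ge0// -powRrM mulVf ?powRr1// pnatr_eq0.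
move: eps01 small => /andP[e0]; rewrite ge_max le_eqVlt.
case/orP => [/eqP eps1|e1] /andP[small_Pi small_delta].
  rewrite eps1 subrr mul0r /phi eqxx mulr1.
  have Pi2 : max_prob p Q <= 2^-1 by exact: le_trans two14.
  apply: prob_le_ge_prob0 => //; rewrite /xi ltxx !mul0r.
  set y := max_prob p Q `^ 8^-1.
  have y0 : 0 <= y := powR_ge0 _ _.
  have y8 : y ^+ 8 = max_prob p Q by exact: powR8.
  have y1 : y <= 1 by rewrite -(@expr_le1 _ 8)// y8; lra.
  have : max_prob p Q <= y by rewrite -y8 ler_iXnr.
  have : y <= Num.max y (Num.max 0 0) by rewrite le_max lexx.
  lra.
move: small_delta large; rewrite /xi e1 !mul1r => small_delta large.
set l1 := _ `^ _; set l2 := _ `^ _; set l3 := _ `^ _.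
set ell := Num.max _ _.
have m0 : 0 < eps ^+ 2 * mu p Q by exact: lt_le_trans large.
have eps0 : 0 < eps.
  by rewrite lt_def e0 andbT; apply: contraTneq m0 => ->; rewrite expr0n mul0r ltxx.
have d0 := delta_ge0 Q p01.
have l10 : 0 <= l1 := powR_ge0 _ _.
have l20 : 0 <= l2 := powR_ge0 _ _.
have l30 : 0 < l3 := powR_gt0 _ m0.
have l18 : l1 ^+ 8 = max_prob p Q by exact: powR8.
have l28 : l2 ^+ 8 = delta p Q by exact: powR8.
(* The exponent [- 4^-1] is chosen for this identity; with [l3 <= ell] it gives the last hypothesis
   of [prob_lower_tail_lt1]. *)
have l34 : eps ^+ 2 * mu p Q * l3 ^+ 4 = 1.
  rewrite /l3 -[(_ `^ _) ^+ 4]powR_mulrn ?powR_ge0// -powRrM mulNr mulVf ?pnatr_eq0//.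
  by rewrite powR_inv1 ?ltW// divff ?gt_eqF.
have ell1 : ell <= 1.
  rewrite !ge_max -(@expr_le1 _ 8)// l18 -(@expr_le1 _ 8 l2)// l28.
  rewrite -(@expr_le1 _ 4 l3) ?(ltW l30)//.
  apply/and3P; split; [lra|lra|].
  by rewrite -l34 ler_peMl// exprn_ge0 ?ltW.
have l1e : l1 <= ell by rewrite le_max lexx.
have l2e : l2 <= ell by rewrite !le_max lexx orbT.
have l3e : l3 <= ell by rewrite !le_max lexx !orbT.
have ell0 : 0 < ell by exact: lt_le_trans l3e.
rewrite phiN_rate//.
apply: (prob_lower_tail_lt1 p01 (eta := Num.max (max_prob p Q) (delta p Q))).
- by rewrite eps0.
- by rewrite ell0.
- by rewrite le_max lexx.
- by rewrite le_max lexx orbT.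
- by rewrite ge_max small_Pi.
- by rewrite ge_max -l18 -l28 !lerXn2r ?nnegrE ?(ltW ell0).
- by rewrite -[leLHS]l34 ler_pM2l// lerXn2r ?nnegrE ?(ltW l30) ?(ltW ell0).
Qed.
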